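(* Let $c>0$, $Q\in\mathbb R\setminus\{0\}$, $M\in\mathbb R$, and let $\zeta:[0,\infty)\to\mathbb R$ be an admissible reduced Hamiltonian, that is, (R1) $\lim_{\mu\to0}\zeta(\mu)/\mu=1$; (R2) $\zeta'(\mu)>0$ and $\zeta(\mu)-\mu\zeta'(\mu)\ge0$ for all $\mu>0$; (R3) $\zeta'(\mu)+2\mu\zeta''(\mu)\ge0$ for all $\mu>0$; (R4) $I_\zeta=2^{-11/4}\int_0^\infty y^{-7/4}\zeta(y)\,dy<\infty$; (R5) there exist positive constants $J_\zeta,K_\zeta,L_\zeta$ such that $J_\zeta\sqrt\mu-K_\zeta\le\zeta(\mu)\le J_\zeta\sqrt\mu$ and $J_\zeta\sqrt\mu-2L_\zeta\le2\zeta'(\mu)\mu\le J_\zeta\sqrt\mu$ for all $\mu>0$. Let $m(r)=M-\frac1{c^2}\int_r^\infty\zeta\big(\tfrac{Q^2}{2s^4}\big)s^2\,ds$, $r>0$, be the cumulative mass function and $m_0=\lim_{r\downarrow0}m(r)$. Then $$m(r)=m_0+\frac1{c^2}\int_0^r\zeta\Big(\frac{Q^2}{2s^4}\Big)s^2\,ds=m_0+\frac{J_\zeta|Q|}{\sqrt2\,c^2}r-\frac{K_\zeta}{3c^2}r^3+O_2(r^3)\qquad\text{as }r\downarrow0.$$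
   Context: $\zeta$ is assumed to have the derivatives $\zeta',\zeta''$ on $(0,\infty)$ that occur in the conditions. Notation: $f(r)=O_k(r^\alpha)$ as $r\downarrow0$ means that $r^{j-\alpha}\frac{d^jf}{dr^j}$ is bounded for $j=0,\dots,k$ as $r\downarrow0$. *)

(* Defs.v *)
From HB Require Import structures.
From mathcomp Require Import all_boot all_order all_algebra.
From mathcomp Require Import all_classical all_reals all_analysis.

Set Implicit Arguments.
Unset Strict Implicit.
Unset Printing Implicit Defensive.

Import Order.TTheory GRing.Theory Num.Theory.
Import numFieldNormedType.Exports.

Local Open Scope classical_set_scope.
Local Open Scope ring_scope.

(* Analytic derivatives; in ring_scope these would otherwise be read as formal
   derivatives of polynomials. *)
Local Notation "f ^` ()" := (derive1 f) : ring_scope.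
Local Notation "f ^` ( n )" := (derive1n n f) : ring_scope.

(* [f = O_k(r^alpha)] as [r] decreases to 0.  [derive1n] is a total operator,
   so the existence of the derivatives up to order [k] on a right
   neighbourhood of 0 is asserted separately. *)
Definition bigOk (R : realType) (k : nat) (alpha : R) (f : R -> R) : Prop :=
  (forall j : nat, (j < k)%N -> \forall r \near 0^'+, derivable f^`(j) r 1) /\
  (forall j : nat, (j <= k)%N ->
     bounded_near (fun r : R => r `^ (j%:R - alpha) * f^`(j) r) 0^'+).

(* The constants are parameters, not existentially bound, because the expansion
   of the mass function refers to them. *)
Definition R5_bounds (R : realType) (zeta : R -> R) (J K L : R) : Prop :=
  [/\ 0 < J, 0 < K, 0 < L &
   forall mu : R, 0 < mu ->
     J * Num.sqrt mu - K <= zeta mu <= J * Num.sqrt mu /\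
     J * Num.sqrt mu - 2 * L <= 2 * zeta^`() mu * mu <= J * Num.sqrt mu].

Definition I_zeta (R : realType) (zeta : R -> R) : \bar R :=
  ((2 `^ (- (11 / 4)))%:E *
   \int[lebesgue_measure]_(y in `]0%R, +oo[) (y `^ (- (7 / 4)) * zeta y)%:E)%E.

(* A function on [0, +oo) is represented by a total function; no condition
   depends on its values at negative arguments. *)
Record admissible (R : realType) (zeta : R -> R) : Prop := Admissible {
  adm_derivable : forall mu : R, 0 < mu -> derivable zeta mu 1;
  adm_derivable2 : forall mu : R, 0 < mu -> derivable zeta^`() mu 1;
  adm_R1 : zeta mu / mu @[mu --> 0^'+] --> (1 : R);
  adm_R2 : forall mu : R, 0 < mu ->
    0 < zeta^`() mu /\ 0 <= zeta mu - mu * zeta^`() mu;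
  adm_R3 : forall mu : R, 0 < mu -> 0 <= zeta^`() mu + 2 * mu * zeta^`(2) mu;
  adm_R4 : (I_zeta zeta < +oo)%E;
  adm_R5 : exists J K L : R, R5_bounds zeta J K L }.

Definition mass_integrand (R : realType) (Q : R) (zeta : R -> R) (s : R) : R :=
  zeta (Q ^+ 2 / (2 * s ^+ 4)) * s ^+ 2.

Definition mass_function (R : realType) (c Q M : R) (zeta : R -> R) (r : R) : R :=
  M - (c ^+ 2)^-1 *
      \int[lebesgue_measure]_(s in `]r, +oo[) mass_integrand Q zeta s.

(* Main.v *)
Require Import Defs.
From HB Require Import structures.
From mathcomp Require Import all_boot all_order all_algebra.
From mathcomp Require Import all_classical all_reals all_analysis.
From mathcomp Require Import measurable_realfun ring lra.

Set Implicit Arguments.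
Unset Strict Implicit.
Unset Printing Implicit Defensive.

Import Order.TTheory GRing.Theory Num.Theory.
Import numFieldNormedType.Exports.

Local Open Scope classical_set_scope.
Local Open Scope ring_scope.

(** With [mu = Q^2 / (2 s^4)] the quantity [J sqrt(mu) s^2] is the constant
    [A = J |Q| / sqrt 2], so (R5) traps the integrand [g s = zeta(mu) s^2]
    between [A - K s^2] and [A].  Since [g' s = 2 s (zeta(mu) - 2 mu zeta'(mu))],
    the two halves of (R5) also cancel the square roots in [g'] and leave
    [|g' s| = O(s)].  The remainder of the mass function has derivative
    [(g r - A + K r^2) / c^2], so these two estimates bound its first two
    derivatives, and integrating the first one bounds the remainder itself.
    At infinity (R1) gives [g s = O(s^-2)], so [g] is integrable. *)

(** Derivatives are local, so a closed formula valid only for positive arguments may be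
    differentiated in place of the original function. *)
Lemma eq_pos_is_derive (R : realType) (f g : R -> R) (r d : R) : 0 < r ->
  (forall x, 0 < x -> f x = g x) -> is_derive r 1 f d -> is_derive r 1 g d.
Proof.
move=> r0 fg; apply: near_eq_is_derive.
by near=> x; apply: fg; near: x; exact: lt_nbhsr.
Unshelve. all: by end_near. Qed.

Lemma bigOk2_cubic (R : realType) (f f1 f2 : R -> R) (B : R) :
  (forall r : R, 0 < r -> is_derive r 1 f (f1 r)) ->
  (forall r : R, 0 < r -> is_derive r 1 f1 (f2 r)) ->
  (forall r : R, 0 < r -> `|f r| <= B * r ^+ 3) ->
  (forall r : R, 0 < r -> `|f1 r| <= B * r ^+ 2) ->
  (forall r : R, 0 < r -> `|f2 r| <= B * r) ->
  bigOk 2 3 f.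
Proof.
move=> df df1 fB f1B f2B.
have f1E (r : R) : 0 < r -> derive1 f r = f1 r.
  by move=> /df ?; rewrite derive1E derive_val.
have ddf (r : R) : 0 < r -> is_derive r 1 (derive1 f) (f2 r).
  move=> r0; apply: eq_pos_is_derive (df1 r r0) => // x /f1E; exact: esym.
have f2E (r : R) : 0 < r -> derive1 (derive1 f) r = f2 r.
  by move=> /ddf ?; rewrite derive1E derive_val.
split=> [[|[|//]] _|j j2].
- by apply: filterS (nbhs_right_gt 0) => r /df[].
- by apply: filterS (nbhs_right_gt 0) => r /ddf[].
apply/ex_bound; exists B; near=> r => /=.
have r0 : 0 < r by [].
(* With [r != 0] the real power splits into [r ^+ j / r ^+ 3], so the goal becomes
   [r ^+ j * |f^(j) r| <= B * r ^+ 3]. *)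
rewrite powRB; last by rewrite (gt_eqF r0) implybT.
rewrite !powR_mulrn ?(ltW r0)// normrM ger0_norm; last first.
  by rewrite divr_ge0// exprn_ge0// ltW.
rewrite mulrAC ler_pdivrMr ?exprn_gt0//.
case: j j2 => [|[|[|//]]] _.
- by rewrite expr0 mul1r fB.
- rewrite (_ : B * _ = r * (B * r ^+ 2)); last by ring.
  by rewrite ler_pM2l// derive1n1 f1E// f1B.
- rewrite (_ : B * _ = r ^+ 2 * (B * r)); last by ring.
  by rewrite ler_pM2l ?exprn_gt0// derive1nS derive1n1 f2E// f2B.
Unshelve. all: by end_near. Qed.

(** * The integrand: derivative, sign and decay at infinity *)

Section integrand.
Variables (R : realType) (Q : R) (zeta : R -> R).
Hypotheses (Q_neq0 : Q != 0) (zeta_adm : admissible zeta).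

Let g := mass_integrand Q zeta.
Let mu (s : R) := Q ^+ 2 / (2 * s ^+ 4).

Lemma arg_gt0 s : 0 < s -> 0 < mu s.
Proof.
move=> s0; rewrite divr_gt0 ?exprn_even_gt0//.
by rewrite mulr_gt0 ?exprn_gt0.
Qed.

Lemma sqrt_argM (s : R) : 0 < s -> Num.sqrt (mu s) * s ^+ 2 = `|Q| / Num.sqrt 2.
Proof.
move=> s0; rewrite /mu sqrtrM ?sqr_ge0// sqrtr_sqr sqrtrV; last first.
  by rewrite mulr_ge0// exprn_ge0// ltW.
rewrite sqrtrM// (_ : s ^+ 4 = (s ^+ 2) ^+ 2); last by ring.
rewrite sqrtr_sqr (ger0_norm (sqr_ge0 s)); field.
by rewrite !gt_eqF ?sqrtr_gt0.
Qed.

(** [mu] is homogeneous of degree -4. Keeping [mu s] in the derivative makes the chain rule produce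
    the product [zeta' * mu] that (R5) controls. *)
Lemma is_derive_arg (s : R) : 0 < s -> is_derive s 1 mu (- (4 * mu s / s)).
Proof.
move=> s0; have s_neq0 : s != 0 by rewrite gt_eqF.
have d4 : is_derive s 1 (fun x : R => 2 * x ^+ 4) (8 * s ^+ 3).
  have -> : (fun x : R => 2 * x ^+ 4) = 2 \*: (@id R ^+ 4).
    by apply/funext => x; rewrite /= fctE.
  by apply: is_derive_eq; rewrite /GRing.scale/=; ring.
have n0 : 2 * s ^+ 4 != 0 by rewrite mulf_neq0// expf_neq0.
have dV := @is_deriveV _ (fun x : R => 2 * x ^+ 4) _ _ _ n0 d4.
have -> : mu = (Q ^+ 2) \*: (fun x : R => (2 * x ^+ 4)^-1).
  by apply/funext => x.
by apply: is_derive_eq; rewrite /= /GRing.scale/=; field.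
Qed.

Lemma is_derive_integrand (s : R) : 0 < s ->
  is_derive s 1 g (2 * s * (zeta (mu s) - 2 * derive1 zeta (mu s) * mu s)).
Proof.
move=> s0; have s_neq0 : s != 0 by rewrite gt_eqF.
have dz : is_derive (mu s) 1 zeta (derive1 zeta (mu s)).
  by apply: DeriveDef; [exact/(adm_derivable zeta_adm)/arg_gt0|rewrite derive1E].
have dc := is_derive1_comp dz (is_derive_arg s0).
have -> : g = (zeta \o mu) * (@id R ^+ 2) by apply/funext => x; rewrite !fctE.
by apply: is_derive_eq; rewrite !fctE /GRing.scale/=; field.
Qed.

Lemma continuous_integrand (s : R) : 0 < s -> {for s, continuous g}.
Proof.
move=> /is_derive_integrand [dg _].
exact/differentiable_continuous/derivable1_diffP.
Qed.

Lemma measurable_integrand : measurable_fun (`]0, +oo[ : set R) g.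
Proof.
apply: open_continuous_measurable_fun => // s.
by rewrite inE/= in_itv/= andbT; exact: continuous_integrand.
Qed.

(** (R2) forces the sign: [zeta mu >= mu * zeta' mu >= 0]. *)
Lemma integrand_ge0 s : 0 < s -> 0 <= g s.
Proof.
move=> /arg_gt0 mu0; rewrite mulr_ge0 ?sqr_ge0//.
have [z'0 z0] := adm_R2 zeta_adm mu0.
rewrite subr_ge0 in z0; apply: le_trans z0.
by rewrite mulr_ge0// ltW.
Qed.

Lemma integrand_tail : exists2 N, 1 <= N &
  forall s, N <= s -> g s <= Q ^+ 2 / s ^+ 2.
Proof.
have : \forall m \near 0^'+, zeta m / m <= 2.
  by apply: (cvgr_le 1 (adm_R1 zeta_adm)); rewrite ltr1n.
case=> d /= d0 zd.
(* For [s >= 1] one has [s < 2 * s ^+ 4], so [Q ^+ 2 / d <= s] already gives [mu s < d], where (R1)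
   yields [zeta <= 2 * mu]. *)
exists (Num.max 1 (Q ^+ 2 / d)); first by rewrite le_max lexx.
move=> s; rewrite ge_max => /andP[s1 sd].
have s0 : 0 < s by lra.
have m0 := arg_gt0 s0.
have : zeta (mu s) / mu s <= 2.
  apply: zd => //=; rewrite sub0r normrN gtr0_norm//.
  rewrite ltr_pdivrMr ?mulr_gt0 ?exprn_gt0//.
  move: sd; rewrite ler_pdivrMr// => /le_lt_trans; apply.
  rewrite mulrC ltr_pM2l//.
  have : s ^+ 1 <= s ^+ 4 by rewrite ler_weXn2l.
  by rewrite expr1; lra.
rewrite ler_pdivrMr// => /(ler_wpM2r (sqr_ge0 s)) /le_trans; apply.
rewrite le_eqVlt; apply/orP; left; apply/eqP; rewrite /mu; field.
by rewrite gt_eqF.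
Qed.

(** * Consequences of (R5) and integrability *)

Variables J K L : R.
Hypothesis zeta_R5 : R5_bounds zeta J K L.

Let A := J * `|Q| / Num.sqrt 2.

Lemma integrand_bounds (s : R) : 0 < s -> A - K * s ^+ 2 <= g s <= A.
Proof.
move=> s0; have [_ _ _ /(_ _ (arg_gt0 s0)) [/andP[z1 z2] _]] := zeta_R5.
rewrite /A -mulrA -(sqrt_argM s0) mulrA -mulrBl.
by rewrite /g /mass_integrand !ler_pM2r ?exprn_gt0//; apply/andP.
Qed.

(** Opposite halves of (R5) are paired: the terms [J * sqrt mu] cancel and [zeta - 2 * zeta' * mu]
    lies between [-K] and [2 * L]. *)
Lemma derive_integrand_bounds (s : R) : 0 < s ->
  - (2 * K * s) <= 2 * s * (zeta (mu s) - 2 * derive1 zeta (mu s) * mu s)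
                <= 4 * L * s.
Proof.
move=> s0; have [_ _ _ /(_ _ (arg_gt0 s0))] := zeta_R5.
move=> [/andP[z1 z2] /andP[y1 y2]].
by apply/andP; split; nra.
Qed.

Lemma integrable_integrand :
  lebesgue_measure.-integrable `]0, +oo[ (fun s : R => (g s)%:E).
Proof.
have [N N1 gN] := integrand_tail.
(* The first summand bounds [g s * (1 + s ^+ 2)] for [s <= N]. Beyond [N >= 1] one has
   [g s <= g s * s ^+ 2 <= Q ^+ 2], whence the second. *)
pose C := A * (1 + N ^+ 2) + 2 * Q ^+ 2.
have A0 : 0 <= A.
  by have [J0 _ _ _] := zeta_R5; rewrite divr_ge0 ?sqrtr_ge0// mulr_ge0// ltW.
have C0 : 0 <= C by have := sqr_ge0 N; have := sqr_ge0 Q; rewrite /C; nra.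
(* [1 / (1 + s^2)] dominates both regimes: [g <= A] near 0 and
   [g = O(s^-2)] at infinity. *)
have gC (s : R) : 0 < s -> g s * oneDsqr s <= C.
  move=> s0; have /andP[_ gA] := integrand_bounds s0.
  rewrite /C /oneDsqr; have [sN|Ns] := leP s N.
    have sN2 : s ^+ 2 <= N ^+ 2 by rewrite ler_pXn2r// ?nnegrE; lra.
    have : g s * (1 + s ^+ 2) <= A * (1 + N ^+ 2).
      by apply: ler_pM; rewrite ?integrand_ge0 ?addr_ge0 ?sqr_ge0 ?lerD2l.
    by have := sqr_ge0 Q; lra.
  have := gN s (ltW Ns); rewrite ler_pdivlMr ?exprn_gt0// => gQ.
  have s1 : 1 <= s ^+ 2 by rewrite exprn_ege1//; lra.
  have : g s * 1 <= g s * s ^+ 2 by rewrite ler_wpM2l// integrand_ge0.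
  have : 0 <= A * (1 + N ^+ 2) by rewrite mulr_ge0// addr_ge0 ?sqr_ge0.
  by rewrite mulrDr; lra.
have dI : lebesgue_measure.-integrable `]0, +oo[
    (fun s : R => C%:E * ((oneDsqr s)^-1)%:E)%E.
  apply: integrableZl => //.
  have oI : lebesgue_measure.-integrable `[0%R, +oo[
      (fun s : R => ((oneDsqr s)^-1)%:E).
    apply/integrableP; split.
      apply/measurable_EFinP; apply: measurable_funTS.
      by apply: continuous_measurable_fun; exact: continuous_oneDsqrV.
    under eq_integral do
      rewrite gee0_abs ?lee_fin ?invr_ge0 ?(le_trans ler01 (oneDsqr_ge1 _))//.
    by rewrite integral0y_oneDsqr ltry.
  apply: integrableS oI => //.
  by apply: subset_itvr; rewrite bnd_simp.
apply: le_integrable dI => //.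
- by apply/measurable_EFinP; exact: measurable_integrand.
- move=> s /=; rewrite in_itv/= andbT => s0.
  have o0 : 0 < oneDsqr s by rewrite (lt_le_trans ltr01) ?oneDsqr_ge1.
  rewrite lee_fin !ger0_norm ?integrand_ge0 ?divr_ge0 ?(ltW o0)//.
  by rewrite ler_pdivlMr// gC.
Qed.

(** * The integral from 0 and the mass function *)

Let G (r : R) := \int[lebesgue_measure]_(s in `]0, r]) g s.

Lemma integrable_integrand_itv (r : R) :
  lebesgue_measure.-integrable `]0, r] (fun s : R => (g s)%:E).
Proof.
apply: (integrableS _ _ _ integrable_integrand) => //.
by apply: subset_itvl; rewrite bnd_simp.
Qed.

(** In the lower bound [s ^+ 2] is replaced by [r ^+ 2], so only constants are integrated. This
    loses a factor 3 in the cubic term, harmless for an O(r^3) estimate. *)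
Lemma integral_bounds (r : R) : 0 < r -> A * r - K * r ^+ 3 <= G r <= A * r.
Proof.
move=> r0.
have ic k : lebesgue_measure.-integrable (`]0, r] : set R) (EFin \o cst k).
  apply: measurable_bounded_integrable => //.
    by rewrite /= lebesgue_measure_itv/= lte_fin r0 sube0 ltry.
  by exists `|k|; split => // x kx s _; exact: ltW.
have cI k : \int[lebesgue_measure]_(s in `]0, r]) k = k * r.
  by rewrite Rintegral_cst//= lebesgue_measure_itv/= lte_fin r0 sube0.
have K0 : 0 < K by have [] := zeta_R5.
rewrite (_ : A * r - _ = (A - K * r ^+ 2) * r); last by ring.
rewrite -!cI; apply/andP; split; apply: le_Rintegral => //;
  try first [exact: integrable_integrand_itv|exact: ic].
- move=> s /=; rewrite in_itv/= => /andP[s0 sr].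
  apply: le_trans (_ : A - K * s ^+ 2 <= _).
    by rewrite lerD2l lerN2 ler_pM2l// ler_pXn2r ?nnegrE// ltW.
  by case/andP: (integrand_bounds s0).
- by move=> s /=; rewrite in_itv/= => /andP[/integrand_bounds/andP[]].
Qed.

Lemma is_derive_integral (r : R) : 0 < r -> is_derive r 1 G (g r).
Proof.
move=> r0.
(* Any endpoint beyond [r] would do: it makes [r] interior to an interval of integrability. *)
have r1 : r < r + 1 by rewrite ltrDl.
have b0 : (BRight 0 < BRight r)%O by rewrite bnd_simp.
have [dG G'] := continuous_FTC1 r1 (integrable_integrand_itv _) b0
  (continuous_integrand r0).
by apply: DeriveDef => //; rewrite -derive1E.
Qed.

(** Splitting the half-line at [r] isolates a part independent of [r], which turns out to be the
    limit at 0. *)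
Lemma mass_functionE (c M r : R) : 0 < r -> mass_function c Q M zeta r =
  M - (c ^+ 2)^-1 * \int[lebesgue_measure]_(s in `]0, +oo[) g s
  + (c ^+ 2)^-1 * G r.
Proof.
move=> r0; rewrite /mass_function.
rewrite -(@Rintegral_itvB _ _ (BRight 0) _ r integrable_integrand);
  rewrite ?bnd_simp ?ltW//.
by rewrite -/g -/(G r); ring.
Qed.

Lemma cvg_mass_function (c M : R) : mass_function c Q M zeta r @[r --> 0^'+] -->
  M - (c ^+ 2)^-1 * \int[lebesgue_measure]_(s in `]0, +oo[) g s.
Proof.
have G0 : G r @[r --> 0^'+] --> 0.
  apply: (@squeeze_cvgr _ _ _ _ (cst 0) (fun r => A * r) G).
  - near=> r; have r0 : 0 < r by [].
    rewrite /= Rintegral_ge0 => [|s /=]; last first.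
      by rewrite in_itv/= => /andP[s0 _]; exact: integrand_ge0.
    by case/andP: (integral_bounds r0).
  - exact: cvg_cst.
  - rewrite -[X in _ --> X](mulr0 A); apply: cvgM; first exact: cvg_cst.
    exact: cvg_at_right_filter.
rewrite -[X in _ --> X]addr0 -[X in _ --> _ + X](mulr0 (c ^+ 2)^-1).
apply: cvg_trans (cvgD (cvg_cst _) (cvgM (cvg_cst _) G0)).
apply: near_eq_cvg; near=> r.
by rewrite mass_functionE.
Unshelve. all: by end_near. Qed.

End integrand.

Theorem proposition3p6 (R : realType) (c Q M : R) (zeta : R -> R)
    (J K L : R) (c_gt0 : 0 < c) (Q_neq0 : Q != 0)
    (zeta_adm : admissible zeta) (zeta_R5 : R5_bounds zeta J K L) :
  let m := mass_function c Q M zeta in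
  let m0 := lim (m r @[r --> 0^'+]) in
  [/\ (* all the integrals below converge *)
      lebesgue_measure.-integrable `]0, +oo[
        (fun s : R => (mass_integrand Q zeta s)%:E),
      cvg (m r @[r --> 0^'+]),
      (forall r : R, 0 < r ->
        m r = m0 + (c ^+ 2)^-1 *
          \int[lebesgue_measure]_(s in `]0, r]) mass_integrand Q zeta s) &
      bigOk 2 3 (fun r : R =>
        m r - (m0 + J * `|Q| / (Num.sqrt 2 * c ^+ 2) * r
               - K / (3 * c ^+ 2) * r ^+ 3))].
Proof.
move=> m m0.
have m_cvg := @cvg_mass_function _ _ _ Q_neq0 zeta_adm _ _ _ zeta_R5 c M.
have m0E : m0 = _ := cvg_lim (@Rhausdorff R) m_cvg.
have mE (r : R) : 0 < r -> m r = m0 + (c ^+ 2)^-1 *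
    \int[lebesgue_measure]_(s in `]0, r]) mass_integrand Q zeta s.
  by move=> r0; rewrite m0E /m (mass_functionE Q_neq0 zeta_adm zeta_R5).
split => //.
- exact: integrable_integrand zeta_R5.
- by apply/cvg_ex; exists m0; rewrite m0E.
have [J0 K0 L0 _] := zeta_R5.
have c2 : 0 < (c ^+ 2)^-1 by rewrite invr_gt0 exprn_gt0.
pose g := mass_integrand Q zeta.
pose A := J * `|Q| / Num.sqrt 2.
pose G (r : R) := \int[lebesgue_measure]_(s in `]0, r]) g s.
pose x (r : R) := Q ^+ 2 / (2 * r ^+ 4).
have s2 : Num.sqrt 2 != 0 :> R by rewrite gt_eqF// sqrtr_gt0.
(* The limit [m0] cancels: the remainder is the integral of [g s - A + K * s ^+ 2] over []0, r]],
   divided by [c ^+ 2]. *)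
have fE (r : R) : 0 < r -> (c ^+ 2)^-1 * (G r - A * r + K / 3 * r ^+ 3) =
    m r - (m0 + J * `|Q| / (Num.sqrt 2 * c ^+ 2) * r - K / (3 * c ^+ 2) * r ^+ 3).
  move=> /mE ->; rewrite -/g -/(G r) /A; field.
  by rewrite s2 gt_eqF.
(* The second derivative dictates the common constant: times [c ^+ 2] it lies between 0 and
   [(2 * K + 4 * L) * r]. For the remainder and its first derivative [K * r ^+ 3] and [K * r ^+ 2]
   would suffice. *)
apply: (@bigOk2_cubic _ _
  (fun r => (c ^+ 2)^-1 * (g r - A + K * r ^+ 2))
  (fun r => (c ^+ 2)^-1 *
    (2 * r * (zeta (x r) - 2 * derive1 zeta (x r) * x r) + 2 * K * r))
  ((c ^+ 2)^-1 * (2 * K + 4 * L))) => r r0.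
- apply: eq_pos_is_derive fE _ => //.
  have dG := is_derive_integral Q_neq0 zeta_adm zeta_R5 r0.
  have -> : (fun r => (c ^+ 2)^-1 * (G r - A * r + K / 3 * r ^+ 3)) =
      (c ^+ 2)^-1 \*: (G - A \*: @id R + (K / 3) \*: (@id R ^+ 3)).
    by apply/funext => y; rewrite !fctE.
  by apply: is_derive_eq; rewrite /GRing.scale/= -/g; field; rewrite gt_eqF.
- have dg := is_derive_integrand Q_neq0 zeta_adm r0.
  have -> : (fun r => (c ^+ 2)^-1 * (g r - A + K * r ^+ 2)) =
      (c ^+ 2)^-1 \*: (g - cst A + K \*: (@id R ^+ 2)).
    by apply/funext => y; rewrite !fctE.
  by apply: is_derive_eq; rewrite /GRing.scale/= -/(x r); field; rewrite gt_eqF.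
- rewrite -fE// normrM gtr0_norm// -[leRHS]mulrA ler_pM2l//.
  have /andP[] := integral_bounds Q_neq0 zeta_adm zeta_R5 r0.
  rewrite -/g -/(G r) -/A => G1 G2.
  have : 0 < r ^+ 3 by rewrite exprn_gt0.
  by rewrite ler_norml => r3; apply/andP; split; nra.
- rewrite normrM gtr0_norm// -[leRHS]mulrA ler_pM2l//.
  have /andP[] := integrand_bounds Q_neq0 zeta_R5 r0.
  rewrite -/g -/A => g1 g2.
  have : 0 < r ^+ 2 by rewrite exprn_gt0.
  by rewrite ler_norml => r3; apply/andP; split; nra.
- rewrite normrM gtr0_norm// -[leRHS]mulrA ler_pM2l//.
  have /andP[] := derive_integrand_bounds Q_neq0 zeta_R5 r0.
  rewrite -/(x r) => d1 d2.
  by rewrite ler_norml; apply/andP; split; nra.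
Qed.
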